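(* For every $k\ge 1$, the $k$-configuration $\chi_{[k]}$ is realizable in $\mathbb{F}_2\times\mathbb{Z}^{k-1}$; and, for every $k\ge 2$, it is not realizable in $\mathbb{F}_2\times\mathbb{Z}^{k-2}$.
   Context: $\mathbb{F}_2$ is the free group of rank $2$ and $\mathbb{Z}^m$ the free-abelian group of rank $m$. For $k\ge 1$, $[k]=\{1,\ldots,k\}$ and $\mathcal{P}([k])$ is its power set. A $k$-configuration is a map $\chi\colon\mathcal{P}([k])\setminus\{\varnothing\}\to\{0,1\}$. The $k$-configuration $\chi_{[k]}$ sends the total set $[k]$ to $1$ and every other nonempty subset of $[k]$ to $0$. Subgroups $H_1,\ldots,H_k$ (possibly with repetitions) of a group $G$ realize $\chi$ if, for every nonempty $I\subseteq[k]$, the intersection $\bigcap_{i\in I}H_i$ is finitely generated when $\chi(I)=0$ and not finitely generated when $\chi(I)=1$. The configuration $\chi$ is realizable in $G$ if some $k$ subgroups of $G$ realize it. *)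

(* Defs.v *)
From HB Require Import structures.
From mathcomp Require Import all_boot all_algebra.
From mathcomp Require Import mathcomp_extra boolp classical_sets cardinality.

Set Implicit Arguments.
Unset Strict Implicit.
Unset Printing Implicit Defensive.

Local Open Scope group_scope.
Local Open Scope classical_set_scope.

(* The free group on T is the set of reduced words over the letters (x, b),
   x : T, where (x, false) stands for x and (x, true) for x^-1. *)
Section FreeGroup.
Variable T : choiceType.
Implicit Types (a b : T * bool) (w u v : seq (T * bool)).

Definition letter_inv a : T * bool := (a.1, ~~ a.2).

Lemma letter_invK : involutive letter_inv.
Proof. by case=> x b; rewrite /letter_inv /= negbK. Qed.

Definition reduced w : bool := sorted (fun a b => b != letter_inv a) w.

Record free_group := FreeGroup { word : seq (T * bool); _ : reduced word }.

HB.instance Definition _ := [isSub for word].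
HB.instance Definition _ := [Choice of free_group by <:].

Definition push a w : seq (T * bool) :=
  if w is b :: w' then if b == letter_inv a then w' else a :: w else [:: a].

Definition word_mul u v : seq (T * bool) := foldr push v u.

Definition word_inv w : seq (T * bool) := rev (map letter_inv w).

Lemma push_reduced a w : reduced w -> reduced (push a w).
Proof.
case: w => [//|b w] /= rw; case: ifP => [_|/negbT nb]; first exact: path_sorted rw.
by rewrite /= nb.
Qed.

Lemma pushK a w : reduced w -> push (letter_inv a) (push a w) = w.
Proof.
case: w => [|b w] /=; first by rewrite letter_invK eqxx.
case: eqP => [-> | nb] rw /=; last by rewrite letter_invK eqxx.
case: w rw => [//|c w] /= /andP[+ _].
by rewrite letter_invK => /negbTE ->.
Qed.

Lemma word_mul_reduced u v : reduced v -> reduced (word_mul u v).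
Proof. by move=> rv; elim: u => //= a u; apply: push_reduced. Qed.

Lemma word_mul_push a u v : reduced v ->
  word_mul (push a u) v = push a (word_mul u v).
Proof.
move=> rv; case: u => [//|b u] /=; case: eqP => [->|//].
have := @pushK (letter_inv a) _ (word_mul_reduced u rv).
by rewrite letter_invK => ->.
Qed.

Lemma word_mulA u v w : reduced w ->
  word_mul u (word_mul v w) = word_mul (word_mul u v) w.
Proof. by move=> rw; elim: u => //= a u ->; rewrite word_mul_push. Qed.

Lemma word_mulw0 w : reduced w -> word_mul w [::] = w.
Proof.
elim: w => //= a w IH rw; rewrite IH; last exact: path_sorted rw.
by case: w rw {IH} => //= b w /andP[/negbTE ->].
Qed.

Lemma word_inv_reduced w : reduced w -> reduced (word_inv w).
Proof.
rewrite /reduced /word_inv rev_sorted sorted_map; apply: sub_sorted => a b /=.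
by apply: contra_neq => ->; rewrite !letter_invK.
Qed.

Lemma word_mulVw w v : reduced v -> word_mul (word_inv w) (word_mul w v) = v.
Proof.
move=> rv; rewrite /word_inv; elim: w => //= a w IH.
by rewrite rev_cons -cats1 /word_mul foldr_cat /= pushK ?word_mul_reduced.
Qed.

Lemma word_invK : involutive word_inv.
Proof. by move=> w; rewrite /word_inv map_rev revK mapK //; apply: letter_invK. Qed.

Lemma word_reduced (x : free_group) : reduced (word x).
Proof. exact: valP x. Qed.

Definition fg_one : free_group := @FreeGroup [::] isT.
Definition fg_mul (x y : free_group) : free_group :=
  FreeGroup (word_mul_reduced (word x) (word_reduced y)).
Definition fg_inv (x : free_group) : free_group :=
  FreeGroup (word_inv_reduced (word_reduced x)).

Lemma fg_mulA : associative fg_mul.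
Proof. by move=> x y z; apply/val_inj/word_mulA/word_reduced. Qed.
Lemma fg_mul1 : left_id fg_one fg_mul.
Proof. by move=> x; apply/val_inj. Qed.
Lemma fg_mulr1 : right_id fg_one fg_mul.
Proof. by move=> x; apply/val_inj/word_mulw0/word_reduced. Qed.
Lemma fg_mulV : left_inverse fg_one fg_inv fg_mul.
Proof.
move=> x; apply/val_inj => /=; rewrite -[X in word_mul _ X]word_mulw0 ?word_reduced //.
exact: word_mulVw.
Qed.
Lemma fg_invK : involutive fg_inv.
Proof. by move=> x; apply/val_inj/word_invK. Qed.
Lemma fg_mulrV : right_inverse fg_one fg_inv fg_mul.
Proof. by move=> x; rewrite -{1}[x]fg_invK fg_mulV. Qed.

HB.instance Definition _ :=
  isGroup.Build free_group fg_mulA fg_mul1 fg_mulr1 fg_mulV fg_mulrV.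

Definition fg_gen (x : T) : free_group := @FreeGroup [:: (x, false)] isT.

Definition letter_eval (G : groupType) (f : T -> G) a : G :=
  if a.2 then (f a.1)^-1 else f a.1.

Lemma free_group_universal (G : groupType) (f : T -> G) :
  exists! g : free_group -> G,
    {morph g : x y / x * y} /\ forall x, g (fg_gen x) = f x.
Proof.
pose ev w := foldr (fun a z => letter_eval f a * z) 1 w.
have evI a : letter_eval f (letter_inv a) = (letter_eval f a)^-1.
  by case: a => x [] //=; rewrite /letter_eval /= invgK.
have ev_push a w : ev (push a w) = letter_eval f a * ev w.
  by case: w => [|b w] //=; case: eqP => [->|//]; rewrite evI mulVKg.
exists (fun x => ev (word x)); split; first split.
- move=> [u ru] [v rv] /=; change (ev (word_mul u v) = ev u * ev v).
  elim: u {ru} => [|a u IH] /=; first by rewrite mul1g.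
  by rewrite ev_push IH mulgA.
- by move=> x; rewrite /= mulg1.
move=> g [gM gf]; apply/funext => -[w rw] /=.
have g1 : g 1 = 1 by apply: (mulgI (g 1)); rewrite -gM !mulg1.
have gV x : g x^-1 = (g x)^-1 by apply: (mulgI (g x)); rewrite -gM !mulgV.
elim: w rw => [|a w IH] rw /=.
  by rewrite -[LHS]g1; congr g; apply/val_inj.
have rw' : reduced w by exact: path_sorted rw.
have -> : FreeGroup rw = (if a.2 then (fg_gen a.1)^-1 else fg_gen a.1) * FreeGroup rw'.
  apply/val_inj; rewrite -[LHS](word_mulw0 rw).
  by case: a rw => x [] rw /=; rewrite word_mulw0.
by rewrite gM IH /letter_eval; congr (_ * _); case: a.2; rewrite ?gV gf.
Qed.

End FreeGroup.

Definition F2 : groupType := free_group 'I_2.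

Definition Zpow (m : nat) : groupType := Algebra.to_multiplicative 'rV[int]_m.

(* Subgroups are arbitrary, not necessarily decidable, subsets. *)
Definition is_subgroup (G : groupType) (H : set G) : Prop :=
  [/\ H 1, forall x y, H x -> H y -> H (x * y) & forall x, H x -> H x^-1].

Definition finitely_generated (G : groupType) (H : set G) : Prop :=
  exists2 S : set G, finite_set S & smallest (@is_subgroup G) S = H.

(* The index set [k] is represented by 'I_k, and the values 0, 1 by false, true. *)
Definition configuration (k : nat) : Type :=
  {I : {set 'I_k} | I != finset.set0} -> bool.

Definition top_configuration (k : nat) : configuration k :=
  fun I => val I == [set: 'I_k]%SET.
Arguments top_configuration : clear implicits.

Definition realizes (G : groupType) (k : nat) (H : 'I_k -> set G)
    (chi : configuration k) : Prop :=
  (forall i, is_subgroup (H i)) /\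
  forall I : {I : {set 'I_k} | I != finset.set0},
    let HI := \bigcap_(i in [set` val I]) H i in
    (chi I = false -> finitely_generated HI) /\
    (chi I = true -> ~ finitely_generated HI).

Definition realizable (G : groupType) (k : nat) (chi : configuration k) : Prop :=
  exists H : 'I_k -> set G, realizes H chi.

(* Main.v *)
Require Import Defs.
From mathcomp Require Import all_boot all_order all_algebra.
From mathcomp Require Import boolp classical_sets cardinality.

Set Implicit Arguments.
Unset Strict Implicit.
Unset Printing Implicit Defensive.

(** Write a subgroup of F x Z^m, with F free, as D and its projection to F as
    pD.  The kernel of D -> pD lies in Z^m, all of whose subgroups are finitely
    generated, so D is finitely generated as soon as pD is
    ([finitely_generated_fst]); everything happens in F.

    Realization.  In F2 x Z^m take the m+1 homomorphisms y_i to Z given by the m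
    coordinates of the vector v and by |w| - (v_1 + ... + v_m), where |w| is the
    exponent sum of the first letter in w, and let H_i be the kernel of y_i.
    The only relation between the y_i is that their sum is |w|.  If the index j
    is missing from I, the value y_j is free to absorb |w|, so the intersection
    over I projects onto F2 and is finitely generated.  The total intersection
    is the kernel of |.| on F2.  It is nontrivial and normalized by the first
    letter, no positive power of which it contains, and this is impossible for a finitely
    generated subgroup of a free group ([normalizer_torsion]).

    Obstruction.  Let H_i, for m+2 indices i, be finitely generated subgroups of
    F x Z^m such that the intersection D_j of the H_i with i <> j is finitely
    generated for each j.  Then D, the intersection of all H_i, is finitely
    generated ([finitely_generated_helly]).  Put E for the intersection of the
    pH_i.  It is finitely generated by Howson's theorem
    ([finitely_generated_bigcap]).  Commutators of elements of E lie in pD,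
    because Z^m is abelian: lift both elements to H_i, for each i, and the
    commutator of the lifts has trivial second component.  It remains to see
    that each x in E has a power in pD, for then E / pD is finite and pD is
    finitely generated ([finitely_generated_torsion_abelian]).  If pD is trivial
    there is nothing to prove; otherwise each pD_j is nontrivial, finitely
    generated and normalized by x, so by [normalizer_torsion] some power of x is
    in pD_j.  Hence one power u of x is in all pD_j, say (u, v_j) is in D_j.  The
    fibres of the H_i over u play the part of m+2 affine subspaces of an
    m-dimensional space, any m+1 of which meet, and Helly's theorem is proved
    in the usual way: a Radon partition of the points v_j ([radon]) gives a
    vector v and some s > 0 with (u^s, v) in every H_i.

    Both facts about free groups rest on one criterion: H is finitely generated
    if and only if the prefixes of the reduced words of H meet only finitely many
    cosets of H, that is, if the core of the Schreier graph of H is finite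
    ([finitely_many_cosets_prefixes], [generated_by_prefix_cosets]). *)

(** * Subgroups and their cosets *)

Section Subgroups.
Local Open Scope group_scope.
Local Open Scope classical_set_scope.
Variable G : groupType.
Implicit Types (H K A B S : set G) (x y z : G).

Definition generated S : set G := smallest (@is_subgroup G) S.

Lemma subgroup1 H : is_subgroup H -> H 1.
Proof. by case. Qed.

Lemma subgroupM H x y : is_subgroup H -> H x -> H y -> H (x * y).
Proof. by case=> _ + _; apply. Qed.

Lemma subgroupV H x : is_subgroup H -> H x -> H x^-1.
Proof. by case=> _ _; apply. Qed.

Lemma subgroupF H x y : is_subgroup H -> H x -> H y -> H (x / y).
Proof. by move=> sH Hx Hy; apply: subgroupM => //; apply: subgroupV. Qed.

Lemma subgroupX H x n : is_subgroup H -> H x -> H (x ^+ n).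
Proof.
move=> sH Hx; elim: n => [|n IH]; first exact: subgroup1.
by rewrite expgS; apply: subgroupM.
Qed.

Lemma subgroup_bigcap (I : Type) (P : set I) (H : I -> set G) :
  (forall i, P i -> is_subgroup (H i)) -> is_subgroup (\bigcap_(i in P) H i).
Proof.
move=> sH; split=> [i Pi|x y Hx Hy i Pi|x Hx i Pi].
- by apply: subgroup1; exact: sH.
- by apply: subgroupM; [exact: sH|exact: Hx|exact: Hy].
- by apply: subgroupV; [exact: sH|exact: Hx].
Qed.

Lemma generated_subgroup S : is_subgroup (generated S).
Proof.
split=> [H [sH _]|x y Sx Sy H HH|x Sx H HH].
- exact: subgroup1.
- by apply: subgroupM; [case: HH|exact: Sx|exact: Sy].
- by apply: subgroupV; [case: HH|exact: Sx].
Qed.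

Lemma finitely_generatedP H S : is_subgroup H -> finite_set S ->
  S `<=` H -> H `<=` generated S -> finitely_generated H.
Proof.
move=> sH fS SH HS; exists S => //; apply/seteqP; split=> //.
exact: smallest_sub.
Qed.

Lemma finitely_generated_subgroup H : finitely_generated H -> is_subgroup H.
Proof. by case=> S _ <-; apply: generated_subgroup. Qed.

(** The set A meets only finitely many right cosets K x.  The cosets are not
    formed: a colouring that separates the elements of A in distinct cosets
    replaces them, and products of colourings then handle intersections. *)
Definition finitely_many_cosets K A :=
  exists n (c : G -> 'I_n), forall x y, A x -> A y -> c x = c y -> K (x / y).

Lemma finitely_many_cosets_colour K A (C : finType) (c : G -> C) :
  (forall x y, A x -> A y -> c x = c y -> K (x / y)) -> finitely_many_cosets K A.
Proof.
move=> cP; exists #|C|, (fun x => enum_rank (c x)) => x y Ax Ay /enum_rank_inj.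
exact: cP.
Qed.

Lemma finitely_many_cosetsS K A B :
  A `<=` B -> finitely_many_cosets K B -> finitely_many_cosets K A.
Proof. by move=> AB [n [c cP]]; exists n, c => x y /AB Bx /AB; apply: cP. Qed.

Lemma coset_representatives K A : finitely_many_cosets K A ->
  exists n (c : G -> 'I_n) (r : 'I_n -> G),
    forall x, A x -> A (r (c x)) /\ K (x / r (c x)).
Proof.
move=> [n [c cP]].
have /choice [r rP] : forall i, exists r, forall x, A x -> c x = i -> A r /\ c r = i.
  move=> i; have [[x [Ax cx]]|nx] := EM (exists x, A x /\ c x = i).
    by exists x.
  by exists 1 => x Ax cx; case: nx; exists x.
exists n, c, r => x Ax; have [Ar cr] := rP _ x Ax erefl.
by split=> //; apply: cP.
Qed.

(** As for the multiplicativity of indices, an element x is determined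
    modulo K by the representative r of its L-coset and by the K-coset of x / r. *)
Lemma finitely_many_cosets_trans K L A :
  finitely_many_cosets L A -> finitely_many_cosets K L -> finitely_many_cosets K A.
Proof.
move=> /coset_representatives [n [c [r rP]]] [m [d dP]].
apply: (@finitely_many_cosets_colour _ _ _ (fun x => (c x, d (x / r (c x))))).
move=> x y Ax Ay [cxy dxy]; rewrite -[x](mulgVK (r (c x))) -[y](mulgVK (r (c y))).
rewrite -cxy mulgKA; apply: dP; last by rewrite dxy cxy.
- by have [] := rP x Ax.
- by rewrite cxy; have [] := rP y Ay.
Qed.

(** A coset of an intersection is an intersection of cosets. *)
Lemma finitely_many_cosets_bigcap (I : finType) (K A : I -> set G) :
  (forall i, finitely_many_cosets (K i) (A i)) ->
  finitely_many_cosets (\bigcap_i K i) (\bigcap_i A i).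
Proof.
move=> fin.
have /choice [c cP] : forall i, exists c : {n & G -> 'I_n},
    forall x y, A i x -> A i y -> tagged c x = tagged c y -> K i (x / y).
  by move=> i; have [n [c cP]] := fin i; exists (existT (fun n => G -> 'I_n) n c).
pose d x : {dffun forall i, 'I_(tag (c i))} := [ffun i => tagged (c i) x].
apply: (@finitely_many_cosets_colour _ _ _ d) => x y Ax Ay dxy i _.
apply: cP; [exact: Ax|exact: Ay|].
by move/ffunP/(_ i): dxy; rewrite !ffunE.
Qed.

End Subgroups.

(** * Cancellation in free groups *)

Section FreeGroups.
Local Open Scope group_scope.
Local Open Scope classical_set_scope.
Variable T : finType.
Local Notation F := (free_group T).
Implicit Types (u v w : seq (T * bool)) (x y p q : F) (H K N : set F).

(** Computing with reduced words amounts to computing with the images in F of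
    arbitrary words, on which concatenation is the product. *)
Definition elt w : F := FreeGroup (word_mul_reduced w (isT : reduced (T:=T) [::])).

Lemma word_elt w : reduced w -> word (elt w) = w.
Proof. exact: word_mulw0. Qed.

Lemma wordK x : elt (word x) = x.
Proof. by apply/val_inj/word_mulw0/word_reduced. Qed.

Lemma word_mul_cat u v w : word_mul (u ++ v) w = word_mul u (word_mul v w).
Proof. exact: foldr_cat. Qed.

Lemma eltM u v : elt (u ++ v) = elt u * elt v.
Proof.
apply/val_inj; rewrite [LHS]word_mul_cat.
by have := @word_mulA _ u [::] _ (word_reduced (elt v)).
Qed.

Lemma eltV w : elt (word_inv w) = (elt w)^-1.
Proof.
apply: (mulIg (elt w)); rewrite mulVg -eltM; apply/val_inj.
by rewrite [LHS]word_mul_cat [LHS]word_mulVw.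
Qed.

Lemma wordV x : word x^-1 = word_inv (word x). Proof. by []. Qed.
Lemma size_word_inv w : size (word_inv w) = size w.
Proof. by rewrite size_rev size_map. Qed.

Lemma reduced_cat u v : reduced (u ++ v) -> reduced u /\ reduced v.
Proof. by case/cat_sorted2. Qed.

Lemma reduced_glue u v w :
  v != [::] -> reduced (u ++ v) -> reduced (v ++ w) -> reduced (u ++ v ++ w).
Proof.
case: v => // a v _; rewrite /reduced cat_cons !sorted_cat_cons /=.
by move=> /andP[-> _] ->.
Qed.

(** All the cancellation in a product takes place at the junction of the two
    reduced words. *)
Lemma word_mul_cancel x y : exists u c v,
  [/\ word x = u ++ c, word y = word_inv c ++ v & word (x * y) = u ++ v].
Proof.
rewrite -[word (x * y)]/(word_mul (word x) (word y)).
elim: (word x) (word_reduced x) => [|a w IH] rw.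
  by exists [::], [::], (word y).
have [|u [c [v [ew ey em]]]] := IH; first by case: (@reduced_cat [:: a] w rw).
rewrite /= em; case: u ew {em} => [|b u] ew; last first.
  exists (a :: b :: u), c, v; rewrite ew; split=> //=.
  by move: rw; rewrite ew /= => /andP[/negbTE->].
case: v ey => [|b v] ey; first by exists [:: a], c, [::]; rewrite ew.
rewrite /=; case: eqP => [eb|_]; last by exists [:: a], c, (b :: v); rewrite ew.
exists [::], (a :: c), v; rewrite ew; split=> //.
by rewrite ey eb /word_inv /= rev_cons -cats1 -catA.
Qed.

(** These are the vertices, read from the base point, of the core of the
    Schreier graph of H. *)
Definition prefixes H : set F := [set p | exists2 h, H h & prefix (word p) (word h)].

Lemma prefixes_sub H K : H `<=` K -> prefixes H `<=` prefixes K.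
Proof. by move=> HK p [h /HK]; exists h. Qed.

Lemma prefix_factor p x : prefix (word p) (word x) ->
  exists2 q, x = p * q & word x = word p ++ word q.
Proof.
move=> /prefixP[v ex].
have [_ rv] : reduced (word p) /\ reduced v.
  by apply: reduced_cat; rewrite -ex word_reduced.
by exists (elt v); rewrite ?word_elt // -[RHS]wordK -[p]wordK -eltM -ex !wordK.
Qed.

Lemma prefix_mul p x y : prefix (word p) (word (x * y)) ->
  prefix (word p) (word x) \/ exists2 q, prefix (word q) (word y) & p = x * q.
Proof.
have [u [c [v [ex ey ->]]]] := word_mul_cancel x y.
have [le_pu|lt_up] := leqP (size (word p)) (size u).
  rewrite prefixE take_cat; case: ltngtP le_pu => // [lt|<-] _ /eqP pE; left.
    by apply/prefixP; exists (drop (size (word p)) u ++ c); rewrite ex catA -{1}pE cat_take_drop.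
  by move: pE; rewrite subnn take0 cats0 => <-; rewrite ex prefix_prefix.
case/prefixP=> w euv; right.
pose v' := drop (size u) (word p).
have ep : word p = u ++ v'.
  rewrite -[LHS](cat_take_drop (size u)); congr (_ ++ _).
  have /= := congr1 (take (size u)) euv; rewrite take_size_cat // => eu.
  by rewrite [RHS]eu takel_cat // ltnW.
have ev : v = v' ++ w.
  by apply/eqP; move/eqP: euv; rewrite ep -catA eqseq_cat // eqxx.
have rq : reduced (word_inv c ++ v').
  by have := word_reduced y; rewrite ey ev catA => /reduced_cat[].
exists (elt (word_inv c ++ v')).
  by rewrite word_elt // ey ev catA prefix_prefix.
by rewrite -[p]wordK -[x]wordK ex ep !eltM eltV mulgA mulgK.
Qed.

Lemma prefix_inv p x : prefix (word p) (word x^-1) -> prefix (word (x * p)) (word x).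
Proof.
move=> /prefix_factor[q ex wx].
have <- : q^-1 = x * p by rewrite -[x]invgK ex invgM mulgVK.
by rewrite -[x]invgK [in X in prefix _ X]wordV wx wordV /word_inv map_cat rev_cat prefix_prefix.
Qed.

(** * Finite generation in free groups *)

(** Let P be the set of prefixes of the generators.  The elements of H all of
    whose prefixes lie in H P contain the generators and form a subgroup,
    because a prefix of x y is a prefix of x or x times a prefix of y, and a
    prefix p of x^-1 gives the prefix x p of x. *)
Lemma finitely_many_cosets_prefixes H :
  finitely_generated H -> finitely_many_cosets H (prefixes H).
Proof.
move=> Hfg; have sH := finitely_generated_subgroup Hfg.
case: Hfg => S /finite_seqP[s Ss] SH.
pose P : seq F := 1 ::
  flatten [seq [seq elt (take i (word x)) | i <- iota 0 (size (word x)).+1] | x <- s].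
pose X := [set h | H h /\ forall p, prefix (word p) (word h) ->
                                exists2 r, r \in P & H (p / r)].
have HX : H `<=` X.
  rewrite -{1}SH; apply: smallest_sub; first split.
  - split=> [|p]; first exact: subgroup1.
    rewrite prefixs0 => /eqP p1; exists 1; first exact: mem_head.
    have -> : p = 1 by apply/val_inj.
    by rewrite mulgV; apply: subgroup1.
  - move=> x y [Hx Px] [Hy Py]; split=> [|p]; first exact: subgroupM.
    case/prefix_mul=> [/Px //|[q /Py[r rP Hq] ->]].
    by exists r => //; rewrite -mulgA; apply: subgroupM.
  - move=> x [Hx Px]; split=> [|p]; first exact: subgroupV.
    case/prefix_inv/Px=> r rP Hr; exists r => //.
    rewrite -[p](mulKg x) -mulgA; apply: subgroupM => //; exact: subgroupV.
  - move=> x Sx; split=> [|p px].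
      by rewrite -SH; apply: sub_gen_smallest.
    exists p; last by rewrite mulgV; apply: subgroup1.
    rewrite in_cons; apply/orP; right; apply/flattenP.
    exists [seq elt (take i (word x)) | i <- iota 0 (size (word x)).+1].
      by apply/mapP; exists x => //; move: Sx; rewrite Ss.
    apply/mapP; exists (size (word p)).
      by rewrite mem_iota /= add0n ltnS size_prefix.
    by move: px; rewrite prefixE => /eqP->; rewrite wordK.
(* The value size P is the colour of the elements outside H P. *)
pose c p : 'I_(size P).+1 := inord (find (fun r => `[<H (p / r)>]) P).
have cP p : prefixes H p -> c p < size P /\ H (p / nth 1 P (c p)).
  case=> h /HX[_ hP] /hP[r rP Hr].
  have hasr : has (fun r => `[<H (p / r)>]) P by apply/hasP; exists r => //; apply/asboolP.
  rewrite /c inordK; last by rewrite ltnS find_size.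
  by split; [rewrite -has_find|apply/asboolP; exact: (nth_find 1 hasr)].
exists (size P).+1, c => x y /cP[_ Hx] /cP[_ Hy] cxy.
by rewrite -(mulgKA (nth 1 P (c x))^-1) {2}cxy; apply: subgroupF.
Qed.

(** Schreier's argument.  Let r(p) represent the coset of the prefix p.  Reading
    h letter by letter, one writes h as a product of the elements
    r(p) a r(p a)^-1, corrected at the two ends; there are finitely many. *)
Lemma generated_by_prefix_cosets H : is_subgroup H ->
  finitely_many_cosets H (prefixes H) -> finitely_generated H.
Proof.
move=> sH /coset_representatives[n [c [r rP]]].
pose S := [set x | H x /\ [\/ exists i, x = (r i)^-1, exists i, x = r i |
                exists t : 'I_n * (T * bool) * 'I_n, x = r t.1.1 * elt [:: t.1.2] / r t.2]].
have fS : finite_set S.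
  pose S' := range (fun i => (r i)^-1) `|` range r `|`
             range (fun t : 'I_n * (T * bool) * 'I_n => r t.1.1 * elt [:: t.1.2] / r t.2).
  apply: (@sub_finite_set _ _ S').
    by move=> x [_ [[i ->]|[i ->]|[t ->]]]; [left; left|left; right|right].
  by rewrite !finite_setU; split; [split|]; apply: finite_image; apply: finite_finset.
apply: (finitely_generatedP sH fS) => [x []//|h Hh].
have sS := generated_subgroup S.
have Sx x : H x -> [\/ exists i, x = (r i)^-1, exists i, x = r i |
    exists t : 'I_n * (T * bool) * 'I_n, x = r t.1.1 * elt [:: t.1.2] / r t.2] ->
    generated S x.
  by move=> Hx xr; apply: sub_gen_smallest.
have pH u v : word h = u ++ v -> prefixes H (elt u).
  move=> hE; exists h => //; rewrite word_elt ?hE ?prefix_prefix //.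
  by have := word_reduced h; rewrite hE => /reduced_cat[].
have Hr u v (hE : word h = u ++ v) := (rP _ (pH u v hE)).2.
have gen u v : word h = u ++ v -> generated S (elt u / r (c (elt u))).
  elim/last_ind: u v => [|u a IH] v hE.
    apply: Sx; first exact: (Hr _ _ hE).
    constructor 1; exists (c (elt [::])).
    have -> : elt [::] = 1 by apply/val_inj.
    by rewrite mul1g.
  have hE' := hE; rewrite cat_rcons in hE'.
  pose ri := r (c (elt u)); pose rj := r (c (elt (rcons u a))).
  have step : elt (rcons u a) / rj = (elt u / ri) * (ri * elt [:: a] / rj).
    by rewrite -cats1 eltM !mulgA mulgVK.
  rewrite step; apply: (subgroupM sS); first exact: (IH _ hE').
  apply: Sx; last first.
    by constructor 3; exists (c (elt u), a, c (elt (rcons u a))).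
  rewrite -(mulKg (elt u / ri) (_ * _ / _)) -step.
  by apply: subgroupM => //; [apply: subgroupV => //; exact: (Hr _ _ hE')|exact: (Hr _ _ hE)].
rewrite -[h](mulgVK (r (c h))); apply: (subgroupM sS).
  by rewrite -{1 2}[h]wordK; apply: (gen _ [::]); rewrite cats0.
apply: Sx; last by constructor 2; exists (c h).
have Hh' : H (h / r (c h)) by apply: (rP _ _).2; exists h => //; rewrite prefix_refl.
by rewrite -(mulKg (h / r (c h)) (r (c h))) mulgVK; apply: subgroupM => //; apply: subgroupV.
Qed.

(** * Normalizers of finitely generated subgroups *)

Lemma reduced_square a w :
  reduced (a :: w) -> reduced ((a :: w) ++ (a :: w)) = (a != letter_inv (last a w)).
Proof.
move=> rw; rewrite [LHS]sorted_cat_cons /= rcons_path.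
by rewrite -/(sorted _ (a :: w)) -/(reduced (a :: w)) rw andbT.
Qed.

(** If the word of x is not cyclically reduced, its last letter is the inverse of
    the first one, and conjugation by the first letter shortens it. *)
Lemma cyclic_reduction x : x != 1 ->
  exists g c, [/\ x = g * elt c / g, c != [::] & reduced (c ++ c)].
Proof.
have [n] := ubnP (size (word x)); elim: n x => // n IH x xn x1.
case ex : (word x) => [|a w]; first by case/eqP: x1; apply: val_inj.
have rw : reduced (a :: w) by rewrite -ex word_reduced.
case: (boolP (a == letter_inv (last a w))) => [|ne]; last first.
  exists 1, (a :: w); split=> //; last by rewrite reduced_square.
  by rewrite invg1 mulg1 mul1g -ex wordK.
case/lastP: w ex rw => [|w b] ex rw; first by case: a {ex rw} => y [] /eqP[].
rewrite last_rcons => /eqP ab.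
have rw' : reduced w by move: rw; rewrite -cats1 -cat1s => /reduced_cat[_ /reduced_cat[]].
have [||g [c [xg c0 rc]]] := IH (elt w).
- by rewrite word_elt //; move: xn; rewrite ex /= size_rcons !ltnS => /ltnW.
- apply: contraTneq rw => /(congr1 (@word _)); rewrite word_elt // => ->.
  by rewrite /= ab letter_invK eqxx.
exists (elt [:: a] * g), c; split=> //.
have -> : x = elt [:: a] * elt w / elt [:: a].
  rewrite -[x]wordK ex -cats1 -cat1s !eltM -mulgA -eltV; congr (_ * (_ * elt _)).
  by rewrite /word_inv /= ab letter_invK.
by rewrite xg invgM !mulgA.
Qed.

Lemma elt_flatten_nseq l c : elt (flatten (nseq l c)) = elt c ^+ l.
Proof.
elim: l => [|l IH]; first exact: val_inj.
by rewrite expgS -IH -eltM.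
Qed.

Lemma reduced_flatten_nseq l c :
  c != [::] -> reduced (c ++ c) -> reduced (T:=T) (flatten (nseq l c)).
Proof.
move=> c0 rc; elim: l => // -[_|l rl].
  by rewrite /= cats0; case: (reduced_cat rc).
exact: reduced_glue.
Qed.

(** The powers of a cyclically reduced c do not cancel among themselves, so g and
    g^-1 cancel at most |g| letters at either end of c^(2 l).  As l > |g|, part
    of each half c^l survives, and the midpoint of the word is reached. *)
Lemma prefix_conj_power g c l : c != [::] -> reduced (c ++ c) -> size (word g) < l ->
  prefix (word (g * elt c ^+ l)) (word (g * elt c ^+ (l + l) / g)).
Proof.
move=> c0 rc lt_gl.
pose v := flatten (nseq l c).
have wv : word (elt c ^+ l) = v.
  by rewrite -elt_flatten_nseq word_elt // reduced_flatten_nseq.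
have sv : size (word g) < size v.
  apply: leq_trans lt_gl _; rewrite size_flatten /shape map_nseq sumn_nseq.
  by rewrite leq_pmull // lt0n size_eq0.
have [u1 [d1 [v1 [eg ev ev1]]]] := word_mul_cancel g (elt c ^+ l).
have [u2 [d2 [v2 [ev' eg' ev2]]]] := word_mul_cancel (elt c ^+ l) g^-1.
rewrite wv in ev ev'.
have v1_neq0 : v1 != [::].
  apply: contraTneq sv => v10; rewrite ev v10 cats0 size_word_inv eg size_cat.
  by rewrite -leqNgt leq_addl.
have u2_neq0 : u2 != [::].
  apply: contraTneq sv => u20; rewrite ev' u20 -leqNgt -(size_word_inv (word g)).
  by rewrite -wordV eg' size_cat size_word_inv leq_addr.
have rvu : reduced (v1 ++ u2).
  have : reduced (v ++ v).
    by rewrite /v -flatten_cat -nseqD reduced_flatten_nseq.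
  by rewrite [in X in X ++ _]ev ev' -catA => /reduced_cat[_]; rewrite catA => /reduced_cat[].
have r1 : reduced (u1 ++ v1) by rewrite -ev1 word_reduced.
have r2 : reduced (u2 ++ v2) by rewrite -ev2 word_reduced.
have r3 : reduced (v1 ++ u2 ++ v2) by apply: reduced_glue.
have r4 : reduced (u1 ++ v1 ++ u2 ++ v2) by apply: reduced_glue.
have -> : g * elt c ^+ (l + l) / g = elt (u1 ++ v1 ++ u2 ++ v2).
  by rewrite catA eltM -ev1 -ev2 !wordK expgnDr !mulgA.
by rewrite ev1 word_elt // catA prefix_prefix.
Qed.

(** Left multiplication by w maps cosets of N into cosets of N, and the core of
    the Schreier graph of N into itself; the core being finite, w^i and w^j, for
    some i > j, send a coset N g to the same one, and w^(i - j) is in N.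
    Concretely, take a nontrivial element g c g^-1 of N with c cyclically
    reduced.  Since w^i g c g^-1 w^-i is again in N, a representative of the
    coset of w^i g is a prefix of an element of N for all i, so two of these
    cosets coincide. *)
Lemma normalizer_torsion N (w : F) :
  finitely_generated N -> (exists2 x, N x & x != 1) ->
  (forall x, N x -> N (w * x / w)) -> exists2 n, 0 < n & N (w ^+ n).
Proof.
move=> Nfg [h Nh /cyclic_reduction [g [c [hE c0 rc]]]] Nw.
have sN := finitely_generated_subgroup Nfg.
have [n [col colP]] := finitely_many_cosets_prefixes Nfg.
pose l i := (size (word (w ^+ i * g))).+1.
(* q i lies in the coset N w^i g and is a prefix of an element of N. *)
pose q i := w ^+ i * g * elt c ^+ l i.
have Nconj i x : N x -> N (w ^+ i * x / w ^+ i).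
  move=> Nx; elim: i => [|i IH]; first by rewrite mul1g invg1 mulg1.
  by rewrite expgS invgM !mulgA -(mulgA w) -mulgA -mulgA; have := Nw _ IH; rewrite !mulgA.
have Npow i j : N (w ^+ i * g * elt c ^+ j / (w ^+ i * g)).
  have -> : w ^+ i * g * elt c ^+ j / (w ^+ i * g) = w ^+ i * (g * elt c ^+ j / g) / w ^+ i.
    by rewrite invgM !mulgA.
  apply: Nconj; elim: j => [|j IH]; first by rewrite mulg1 mulgV; apply: subgroup1.
  have -> : g * elt c ^+ j.+1 / g = (g * elt c ^+ j / g) * h.
    by rewrite hE expgSr !mulgA mulgVK.
  exact: subgroupM.
have qN i : prefixes N (q i).
  by exists (w ^+ i * g * elt c ^+ (l i + l i) / (w ^+ i * g)); rewrite ?prefix_conj_power.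
have /injectivePn[i [j ne_ij ceq]] : ~~ injectiveb (fun i : 'I_n.+1 => col (q i)).
  by apply/injectiveP => /leq_card; rewrite !card_ord ltnn.
have Nij (i' j' : nat) : col (q i') = col (q j') -> N (w ^+ i' / w ^+ j').
  move=> cij; have Nq := colP _ _ (qN i') (qN j') cij.
  have -> : w ^+ i' / w ^+ j' = (w ^+ i' * g * elt c ^+ l i' / (w ^+ i' * g))^-1 *
      (q i' / q j') * (w ^+ j' * g * elt c ^+ l j' / (w ^+ j' * g)).
    by rewrite /q !invgM !mulgA !(mulgVK, mulgK, invgK).
  by apply: subgroupM => //; apply: subgroupM => //; apply: subgroupV.
case: (ltngtP i j) ne_ij => [lt_ij|lt_ji|/val_inj->] => [_|_|]; last by rewrite eqxx.
- exists (j - i); first by rewrite subn_gt0.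
  by rewrite expgnFr 1?ltnW //; apply: Nij.
- exists (i - j); first by rewrite subn_gt0.
  by rewrite expgnFr 1?ltnW //; apply: Nij.
Qed.

End FreeGroups.

(** * Finitely generated torsion abelian quotients *)

Section TorsionAbelianQuotients.
Local Open Scope group_scope.
Local Open Scope classical_set_scope.
Variable G : groupType.
Implicit Types (H K E S : set G) (x y z : G).

(** The quotient E / K is abelian and torsion, hence finite if E is finitely
    generated.  The induction adjoins the generators of E to K one at a time, so
    it is stated for a list s such that K and s generate E; adjoining a to K
    gives the subgroup of the k a^e, and only the e below some n > 0 with a^n in K are
    needed. *)
Lemma finitely_many_cosets_torsion_abelian K E :
  finitely_generated E -> is_subgroup K -> K `<=` E ->
  (forall x y, E x -> E y -> K [~ x, y]) ->
  (forall x, E x -> exists2 n, 0 < n & K (x ^+ n)) ->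
  finitely_many_cosets K E.
Proof.
move=> Efg; have sE := finitely_generated_subgroup Efg.
case: Efg => S /finite_seqP[s ->] SE.
have : E `<=` generated (K `|` [set` s]).
  by rewrite -SE; apply: sub_smallest2r; [exact: generated_subgroup|move=> x; right].
have : [set` s] `<=` E by rewrite -SE; apply: sub_gen_smallest.
move=> {SE}; elim: s K => [|a s IH] K sSE genE sK KE comm tors.
  apply: (@finitely_many_cosets_colour _ _ _ unit (fun=> tt)) => x y Ex Ey _.
  have EK : E `<=` K.
    by apply: subset_trans genE _; apply: smallest_sub => // z [].
  by apply: subgroupF => //; apply: EK.
have Ea : E a by apply: sSE; rewrite /= mem_head.
have Knorm x k : E x -> K k -> K (x * k / x).
  move=> Ex Kk; have -> : x * k / x = [~ x^-1, k^-1] * k.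
    by rewrite commgEl conjgE !invgK !mulgA mulgVK.
  by apply: subgroupM => //; apply: comm; apply: subgroupV => //; apply: KE.
pose L := [set x | E x /\ exists e, K (x / a ^+ e)].
have KL : K `<=` L.
  by move=> x Kx; split; [exact: KE|exists 0; rewrite invg1 mulg1].
have LM x y : L x -> L y -> L (x * y).
  move=> [Ex [e Ke]] [Ey [f Kf]]; split; first exact: subgroupM.
  exists (e + f); have -> : x * y / a ^+ (e + f) = (x * (y / a ^+ f) / x) * (x / a ^+ e).
    by rewrite expgnDr invgM !mulgA mulgVK.
  by apply: subgroupM => //; apply: Knorm.
have LX x n : L x -> L (x ^+ n).
  move=> Lx; elim: n => [|n IHn]; first by apply: KL; apply: subgroup1.
  by rewrite expgS; apply: LM.
have sL : is_subgroup L.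
  split=> // [|x Lx]; first by apply: KL; apply: subgroup1.
  have [[|n] // _ Kn] := tors x Lx.1.
  have -> : x^-1 = (x ^+ n.+1)^-1 * x ^+ n by rewrite expgSr invgM mulgVK.
  by apply: LM; [apply: KL; apply: subgroupV|apply: LX].
apply: (@finitely_many_cosets_trans _ _ L).
  apply: IH => // [x sx|x Ex|x []//|x y Ex Ey|x Ex].
  - by apply: sSE; rewrite /= in_cons orbC sx.
  - apply: smallest_sub (genE x Ex); first exact: generated_subgroup.
    move=> z [Kz|]; first by apply: sub_gen_smallest; left; apply: KL.
    rewrite /= in_cons => /orP[/eqP->|zs]; apply: sub_gen_smallest; last by right.
    by left; split=> //; exists 1%N; rewrite mulgV; apply: subgroup1.
  - by apply: KL; apply: comm.
  - by have [n n0 Kn] := tors x Ex; exists n => //; apply: KL.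
have [n n0 Kn] := tors a Ea.
have /choice [e eP] : forall x, exists e : 'I_n, L x -> K (x / a ^+ e).
  move=> x; have [[Ex [e Ke]]|nLx] := EM (L x); last by exists (Ordinal n0).
  exists (Ordinal (ltn_pmod e n0)) => _ /=.
  have -> : x / a ^+ (e %% n) = (x / a ^+ e) * (a ^+ n) ^+ (e %/ n).
    rewrite {2}(divn_eq e n) expgnDr invgM -expgnA mulnC !mulgA mulgVK //.
  by apply: subgroupM => //; apply: subgroupX.
apply: (@finitely_many_cosets_colour _ _ _ _ e) => x y Lx Ly exy.
by rewrite -(mulgKA (a ^+ e x)^-1) {2}exy; apply: subgroupF => //; apply: eP.
Qed.

End TorsionAbelianQuotients.

(** * Homomorphic images and extensions *)

Section Extensions.
Local Open Scope group_scope.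
Local Open Scope classical_set_scope.
Variables (G G' : groupType) (f : G -> G').
Hypothesis fM : {morph f : x y / x * y}.
Implicit Types (H : set G) (S : set G) (x y : G).

Lemma morph_one : f 1 = 1.
Proof. by apply: (mulgI (f 1)); rewrite -fM !mulg1. Qed.

Lemma morph_inv : {morph f : x / x^-1}.
Proof. by move=> x; apply: (mulgI (f x)); rewrite -fM !mulgV morph_one. Qed.

Lemma finitely_generated_image H :
  finitely_generated H -> finitely_generated (f @` H).
Proof.
move=> Hfg; have sH := finitely_generated_subgroup Hfg.
have [S fS SH] := Hfg; have SsubH : S `<=` H by rewrite -SH; apply: sub_gen_smallest.
apply: (@finitely_generatedP _ _ (f @` S)).
- split=> [|_ _ [x Hx <-] [y Hy <-]|_ [x Hx <-]].
  + by exists 1; [exact: subgroup1|exact: morph_one].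
  + by exists (x * y); [exact: subgroupM|exact: fM].
  + by exists x^-1; [exact: subgroupV|exact: morph_inv].
- exact: finite_image.
- exact: image_subset.
have sfS := generated_subgroup (f @` S).
have : H `<=` [set x | generated (f @` S) (f x)].
  rewrite -SH; apply: smallest_sub => [|x Sx]; last first.
    by apply: sub_gen_smallest; exists x.
  split=> [|x y /= Sx Sy|x /= Sx].
  - by rewrite /= morph_one; apply: subgroup1.
  - by rewrite /= fM; apply: (subgroupM sfS).
  - by rewrite /= morph_inv; apply: (subgroupV sfS).
by move=> HfS _ [x /HfS Hx <-].
Qed.

(** Lifts of generators of the image, together with generators of the kernel,
    generate. *)
Lemma finitely_generated_extension H : is_subgroup H ->
  finitely_generated (f @` H) -> finitely_generated (H `&` [set x | f x = 1]) ->
  finitely_generated H.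
Proof.
move=> sH [S' fS' S'H] [S fS SH].
have /choice [t tP] : forall y : G', exists x, S' y -> H x /\ f x = y.
  move=> y; have [S'y|nS'y] := EM (S' y); last by exists 1.
  have [x Hx fx] : (f @` H) y by rewrite -S'H; apply: sub_gen_smallest.
  by exists x.
pose U := S `|` t @` S'.
have sU := generated_subgroup U.
have U_S : generated S `<=` generated U.
  by apply: sub_smallest2r => // x Sx; left.
have UH : generated U `<=` H.
  apply: smallest_sub => // x [Sx|[y /tP[Hy _] <-] //].
  by have [] : (H `&` [set x | f x = 1]) x by rewrite -SH; apply: sub_gen_smallest.
apply: (@finitely_generatedP _ _ U) => //.
- by rewrite finite_setU; split=> //; apply: finite_image.
- exact: subset_trans (@sub_gen_smallest _ _ U) UH.
have lift : f @` H `<=` f @` generated U.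
  rewrite -S'H; apply: smallest_sub.
    split=> [|_ _ [x Ux <-] [y Uy <-]|_ [x Ux <-]].
    - by exists 1; [exact: (subgroup1 sU)|exact: morph_one].
    - by exists (x * y); [exact: (subgroupM sU)|exact: fM].
    - by exists x^-1; [exact: (subgroupV sU)|exact: morph_inv].
  move=> y S'y; exists (t y); last by have [] := tP y S'y.
  by apply: sub_gen_smallest; right; exists y.
move=> x Hx; have [y Uy fyx] : (f @` generated U) (f x) by apply: lift; exists x.
rewrite -(mulgVK y x); apply: (subgroupM sU) => //; apply: U_S.
have : (H `&` [set x | f x = 1]) (x / y).
  split; first by apply: subgroupF => //; apply: UH.
  by rewrite /= fM morph_inv fyx mulgV.
by rewrite -SH.
Qed.

End Extensions.

(** * Free abelian groups *)

Section FreeAbelian.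
Local Open Scope ring_scope.
Local Open Scope classical_set_scope.
Import GRing.Theory Num.Theory Order.TTheory.

Local Notation Zmul := (Algebra.to_multiplicative int : groupType).

Lemma subgroup_mulz (A : set Zmul) (d q : int) :
  is_subgroup A -> A d -> A (q * d).
Proof.
move=> sA Ad; have natA (n : nat) : A (n%:Z * d).
  elim: n => [|n IH]; first by rewrite mul0r; apply: (subgroup1 sA).
  by rewrite intS mulrDl mul1r; apply: (subgroupM sA Ad IH).
case: (intP q) => [|n|n]; [exact: (natA 0%N)|exact: natA|].
by rewrite mulNr; apply: (subgroupV sA (natA _)).
Qed.

(** Euclidean division by the least positive element. *)
Lemma finitely_generated_int (A : set Zmul) : is_subgroup A -> finitely_generated A.
Proof.
move=> sA; have [exA|noA] := EM (exists n : nat, (0 < n)%N /\ A n%:Z); last first.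
  apply: (@finitely_generatedP _ _ set0) => // x Ax.
  have -> : x = 1%g; last exact: (subgroup1 (generated_subgroup set0)).
  case: (intP x) Ax => [//|n|n] Ax; case: noA; exists n.+1; split=> //.
  by have := subgroupV sA Ax; rewrite -[(_^-1)%g]/(- - (n.+1)%:Z) opprK.
have exA' : exists n : nat, (0 < n)%N && `[<A n%:Z>].
  by have [n [n0 An]] := exA; exists n; rewrite n0; apply/asboolP.
case: (ex_minnP exA') => d /andP[d0 /asboolP Ad] dmin.
apply: (@finitely_generatedP _ _ [set d%:Z : Zmul]) => //.
  by move=> _ ->.
move=> x Ax; rewrite (divz_eq x d).
have d_neq0 : d%:Z != 0 by rewrite eqz_nat -lt0n.
have Ar : A (x %% d)%Z.
  have -> : (x %% d)%Z = x + - ((x %/ d)%Z * d) by rewrite {2}(divz_eq x d) addrC addKr.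
  by apply: (subgroupF sA Ax); apply: subgroup_mulz.
have -> : (x %% d)%Z = 0.
  have r0 := modz_ge0 x d_neq0; have rd := ltz_pmod x (d0 : 0 < d%:Z).
  case: ((x %% d)%Z) Ar r0 rd => // -[//|r] Ar _ rd.
  have dr : (d <= r.+1)%N by apply: dmin; apply/asboolP.
  by rewrite ltz_nat ltnNge dr in rd.
rewrite addr0; apply: (subgroup_mulz _ (generated_subgroup _)).
by apply: sub_gen_smallest.
Qed.

(** Induction on the number j of coordinates that may be nonzero on L: the last
    of them maps L onto a subgroup of Z, with a kernel that uses fewer. *)
Lemma finitely_generated_Zpow (m : nat) (L : set (Zpow m)) :
  is_subgroup L -> finitely_generated L.
Proof.
pose supp (j : nat) (L : set (Zpow m)) :=
  forall v : 'rV[int]_m, L v -> forall i : 'I_m, (j <= i)%N -> v 0 i = 0.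
suff fg j : forall L, is_subgroup L -> supp j L -> finitely_generated L.
  by move=> sL; apply: (fg m) => // v _ i; rewrite leqNgt ltn_ord.
elim: j => [|j IH] {}L sL supL.
  apply: (@finitely_generatedP _ _ set0) => // v Lv.
  have -> : v = 1%g; last exact: (subgroup1 (generated_subgroup set0)).
  by apply/rowP => i; rewrite (supL v Lv) // mxE.
have [jm|mj] := ltnP j m; last first.
  apply: IH => // v Lv i ji; have := leq_trans mj ji.
  by rewrite leqNgt ltn_ord.
pose f (v : Zpow m) : Zmul := (v : 'rV[int]_m) 0 (Ordinal jm).
have fM : {morph f : x y / (x * y)%g} by move=> x y; rewrite /f mxE.
apply: (finitely_generated_extension fM sL).
  apply: finitely_generated_int; split=> [|_ _ [x Lx <-] [y Ly <-]|_ [x Lx <-]].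
  - by exists 1%g; [exact: (subgroup1 sL)|exact: (morph_one fM)].
  - by exists (x * y)%g; [exact: (subgroupM sL)|exact: fM].
  - by exists x^-1%g; [exact: (subgroupV sL)|exact: (morph_inv fM)].
apply: IH => [|v [Lv fv] i ji].
  split=> [|x y [Lx fx] [Ly fy]|x [Lx fx]]; split.
  - exact: (subgroup1 sL).
  - exact: (morph_one fM).
  - exact: (subgroupM sL).
  - by rewrite /= fM fx fy mulg1.
  - exact: (subgroupV sL).
  - by rewrite /= (morph_inv fM) fx invg1.
move: ji; rewrite leq_eqVlt => /orP[/eqP ji|ji]; last exact: supL.
by rewrite -[RHS]fv; congr (v 0 _); apply: val_inj.
Qed.

(** Radon's theorem with integral coefficients.  The m+2 vectors (v_i, 1) of
    Q^(m+1) satisfy a linear relation, with integral coefficients c_i after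
    clearing denominators; its positive part a and its negative part b have
    disjoint supports. *)
Lemma radon (m : nat) (v : 'I_m.+2 -> 'rV[int]_m) :
  exists a b : 'I_m.+2 -> nat,
  [/\ forall i, a i = 0%N \/ b i = 0%N, (0 < \sum_i a i)%N,
      (\sum_i a i = \sum_i b i)%N & \sum_i v i *+ a i = \sum_i v i *+ b i].
Proof.
pose M : 'M[rat]_(m.+2, m + 1) :=
  \matrix_i row_mx (map_mx intr (v i)) (const_mx 1).
have /rowV0Pn [u /sub_kermxP uM u0] : kermx M != 0.
  by rewrite kermx_eq0 /row_free neq_ltn (leq_ltn_trans (rank_leq_col M)) // addn1.
have [c [c0 cs cv]] : exists c : 'I_m.+2 -> int,
   [/\ exists i, c i != 0, \sum_i c i = 0 & \sum_i c i *: v i = 0].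
  have [q [d d0 qE]] := rat_poly_scale (rVpoly u).
  have cE (i : 'I_m.+2) : (q`_i)%:~R = d%:~R * u 0 i.
    rewrite -(coef_rVpoly_ord u) qE coefZ coef_map mulrA mulfV ?mul1r //.
    by rewrite intr_eq0.
  have col (l : 'I_(m + 1)) (x : 'I_m.+2 -> int) :
      (forall i, M i l = (x i)%:~R) -> \sum_(i < m.+2) q`_i * x i = 0.
    move=> Ml; apply/eqP; rewrite -(intr_eq0 rat) rmorph_sum /=.
    apply/eqP; transitivity (d%:~R * (u *m M) 0 l); last by rewrite uM mxE mulr0.
    rewrite mxE mulr_sumr; apply: eq_bigr => i _.
    by rewrite rmorphM /= cE Ml mulrA.
  exists (fun i : 'I_m.+2 => q`_i); split.
  - have /rV0Pn [i ui] : u != 0 by [].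
    by exists i; rewrite -(intr_eq0 rat) cE mulf_neq0 // intr_eq0.
  - have := col (rshift m 0) (fun=> 1); under eq_bigr do rewrite mulr1.
    by apply=> i; rewrite mxE row_mxEr mxE.
  - apply/rowP => l; rewrite summxE mxE; under eq_bigr do rewrite mxE.
    by apply: (col (lshift 1 l)) => i; rewrite mxE row_mxEl mxE.
pose a i := if 0 <= c i then `|c i|%N else 0%N.
pose b i := if 0 <= c i then 0%N else `|c i|%N.
have cab i : c i = (a i)%:Z - (b i)%:Z.
  rewrite /a /b; case: ifPn => [ci|]; first by rewrite subr0 gez0_abs.
  by rewrite -ltNge => ci; rewrite sub0r ltz0_abs // opprK.
have sab : (\sum_i a i = \sum_i b i)%N.
  apply/eqP; rewrite -eqz_nat -subr_eq0 -!natz !natr_sum -sumrB.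
  by apply/eqP; apply: etrans cs; apply: eq_bigr => i _; rewrite cab !natz.
exists a, b; split=> //.
- by move=> i; rewrite /a /b; case: ifP; [right|left].
- rewrite lt0n; apply/negP => a0.
  have b0 : (\sum_i b i)%N == 0%N by rewrite -sab.
  rewrite !sum_nat_eq0 in a0 b0; have [i /eqP[]] := c0.
  by rewrite cab (eqP (forallP a0 i)) (eqP (forallP b0 i)).
apply/eqP; rewrite -subr_eq0 -sumrB; apply/eqP; apply: etrans cv; apply: eq_bigr => i _.
by rewrite cab scalerBl -!natz !scaler_nat.
Qed.

End FreeAbelian.

(** * Howson's theorem and subgroups with finite quotient *)

Section FreeByTorsionAbelian.
Local Open Scope group_scope.
Local Open Scope classical_set_scope.
Variable T : finType.
Implicit Types H K E : set (free_group T).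

(** Howson's theorem: a prefix of an element of the intersection is a prefix of
    an element of each H_i, so the cosets to count are intersections of finitely
    many possible cosets of the H_i. *)
Lemma finitely_generated_bigcap (I : finType) (H : I -> set (free_group T)) :
  (forall i, finitely_generated (H i)) -> finitely_generated (\bigcap_i H i).
Proof.
move=> Hfg; apply: generated_by_prefix_cosets.
  by apply: subgroup_bigcap => i _; apply: finitely_generated_subgroup.
apply: (@finitely_many_cosetsS _ _ _ (\bigcap_i prefixes (H i))).
  by move=> p [h Hh ph] i _; exists h => //; apply: Hh.
by apply: finitely_many_cosets_bigcap => i; apply: finitely_many_cosets_prefixes.
Qed.

(** Being finitely generated passes from E to a subgroup K of finite index: the
    prefixes of K are prefixes of E. *)
Lemma finitely_generated_torsion_abelian K E :
  finitely_generated E -> is_subgroup K -> K `<=` E ->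
  (forall x y, E x -> E y -> K [~ x, y]) ->
  (forall x, E x -> exists2 n, 0 < n & K (x ^+ n)) ->
  finitely_generated K.
Proof.
move=> Efg sK KE comm tors; apply: generated_by_prefix_cosets => //.
apply: (@finitely_many_cosets_trans _ _ E).
  apply: finitely_many_cosetsS (finitely_many_cosets_prefixes Efg).
  exact: prefixes_sub.
exact: finitely_many_cosets_torsion_abelian.
Qed.

End FreeByTorsionAbelian.

(** * Subgroups of a free times a free abelian group *)

Section FreeTimesFreeAbelian.
Local Open Scope group_scope.
Local Open Scope classical_set_scope.
Variables (T : finType) (m : nat).
Local Notation F := (free_group T).
Local Notation G := (F * Zpow m)%type.
Implicit Types (H : set G).

Let fstM : {morph (fst : G -> F) : x y / x * y}. Proof. by []. Qed.

(** The kernel of the projection of H to the free factor is a subgroup of Z^m. *)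
Lemma finitely_generated_fst H :
  is_subgroup H -> finitely_generated (fst @` H) -> finitely_generated H.
Proof.
move=> sH Hfg; apply: (finitely_generated_extension fstM) => //.
pose f (v : Zpow m) : G := (1, v).
have fM : {morph f : x y / x * y} by move=> x y; rewrite /f; congr pair; rewrite mul1g.
have -> : H `&` [set x | x.1 = 1] = f @` [set v | H (1, v)].
  apply/seteqP; split=> [[w v] [/= + w1]|_ [v Hv <-]] //.
  by rewrite w1 => Hv; exists v.
apply/(finitely_generated_image fM)/finitely_generated_Zpow.
split=> [|v v' Hv Hv'|v Hv]; first exact: (subgroup1 sH).
- by have := subgroupM sH Hv Hv'; rewrite /= -[X in H X]/(1 * 1, v * v') mulg1.
- by have := subgroupV sH Hv; rewrite /= -[X in H X]/(1^-1, v^-1) invg1.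
Qed.

Lemma expg_pair (u : F) (v : Zpow m) n : ((u, v) : G) ^+ n = (u ^+ n, v ^+ n).
Proof. by elim: n => // n IH; rewrite !expgS IH. Qed.

(** The product of the (u, v_i)^(a_i), which commute.  Only the indices with
    a_i <> 0 matter: this is where the disjoint supports of a Radon partition
    are used. *)
Lemma subgroup_combination H (I : finType) (u : F) (v : I -> Zpow m) (a : I -> nat) :
  is_subgroup H -> (forall i, a i != 0 -> H (u, v i)) ->
  H (u ^+ (\sum_i a i), (\sum_i (v i : 'rV[int]_m) *+ a i)%R).
Proof.
move=> sH Hv.
apply: (big_ind2 (fun n t => H (u ^+ n, t))); first exact: (subgroup1 sH).
  by move=> n1 t1 n2 t2 H1 H2; have := subgroupM sH H1 H2; rewrite expgnDr.
move=> i _; case: (eqVneq (a i) 0) => [->|ai]; first exact: (subgroup1 sH).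
by have := subgroupX (a i) sH (Hv i ai); rewrite expg_pair.
Qed.

End FreeTimesFreeAbelian.

(** * The obstruction *)

Section Helly.
Local Open Scope group_scope.
Local Open Scope classical_set_scope.
Variables (T : finType) (m : nat).
Local Notation F := (free_group T).
Local Notation G := (F * Zpow m)%type.

(** Helly's theorem for finite generation.  Let E be the intersection
    of the projections pH_i to F.  If the projection pD of the total
    intersection D is nontrivial, it has finite index in E. *)
Lemma finitely_generated_helly (H : 'I_m.+2 -> set G) :
  (forall i, finitely_generated (H i)) ->
  (forall j, finitely_generated (\bigcap_(i in [set i | i != j]) H i)) ->
  finitely_generated (\bigcap_i H i).
Proof.
move=> Hfg Dfg; have sH i := finitely_generated_subgroup (Hfg i).
have fstM : {morph (fst : G -> F) : x y / x * y} by [].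
pose D := \bigcap_i H i; pose D_ j := \bigcap_(i in [set i | i != j]) H i.
pose E := \bigcap_i (fst @` H i); pose K : set F := fst @` D.
have sD : is_subgroup D by apply: subgroup_bigcap.
have sDj j : is_subgroup (D_ j) by apply: subgroup_bigcap.
have sK : is_subgroup K.
  split=> [|_ _ [x Dx <-] [y Dy <-]|_ [x Dx <-]].
  - by exists 1 => //; apply: (subgroup1 sD).
  - by exists (x * y) => //; apply: (subgroupM sD).
  - by exists x^-1 => //; apply: (subgroupV sD).
apply: finitely_generated_fst => //; rewrite -/D -/K.
have [[k Kk k1]|K1] := EM (exists2 k, K k & k != 1); last first.
  apply: (@finitely_generatedP _ _ set0) => // x Kx.
  have -> : x = 1; last exact: (subgroup1 (generated_subgroup set0)).
  by apply/eqP/negPn/negP => x1; apply: K1; exists x.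
have lift x i : E x -> exists v, H i (x, v).
  by move=> Ex; have [[w v] Hwv <-] := Ex i I; exists v.
apply: (@finitely_generated_torsion_abelian _ _ E) => //.
- apply: finitely_generated_bigcap => i; exact: finitely_generated_image.
- by move=> _ [x Dx <-] i _; exists x => //; apply: Dx.
- move=> x y Ex Ey; exists ([~ x, y], 1) => // i _.
  have [v Hv] := lift x i Ex; have [v' Hv'] := lift y i Ey.
  have -> : ([~ x, y], 1) = [~ (x, v), (y, v')] :> G.
    rewrite -[RHS]/([~ x, y], [~ v, v']); congr pair.
    by apply/esym/eqP/commgP; apply: Algebra.commuteT.
  by rewrite commgEl conjgE; do ?[apply: (subgroupM (sH i)) | apply: (subgroupV (sH i))].
move=> x Ex.
(* The element x normalizes each pD_j, so a power of x falls into it. *)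
have /choice [n nP] : forall j, exists n, 0 < n /\ (fst @` D_ j) (x ^+ n).
  move=> j; suff [n n0 Dn] : exists2 n, 0 < n & (fst @` D_ j) (x ^+ n) by exists n.
  apply: normalizer_torsion.
  - exact/(finitely_generated_image fstM)/Dfg.
  - by exists k => //; case: Kk => y Dy <-; exists y => // i _; apply: Dy.
  move=> _ [[y t] Dyt <-]; exists (x * y / x, t) => // i ij.
  have [v Hv] := lift x i Ex; have Hyt := Dyt i ij.
  have -> : (x * y / x, t) = (x, v) * (y, t) / (x, v) :> G.
    rewrite -[RHS]/(x * y / x, v * t / v); congr pair.
    by rewrite (Algebra.commuteT v t) mulgK.
  by apply: (subgroupF (sH i)) => //; apply: (subgroupM (sH i)).
pose N := (\prod_j n j)%N; pose u := x ^+ N.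
have /choice [v vP] : forall j, exists v, D_ j (u, v).
  move=> j; have [_ [[w t] /= Dt wE]] := nP j.
  (* Dt says that (x^(n j), t) is in D_ j; N is a multiple of n j. *)
  exists (t ^+ (\prod_(i | i != j) n i)%N).
  have := subgroupX (\prod_(i | i != j) n i)%N (sDj j) Dt.
  have NE : N = (n j * \prod_(i | i != j) n i)%N by apply: bigD1.
  by rewrite expg_pair wE -expgnA -NE.
have [a [b [ab a0 sab vab]]] := radon v.
exists (N * \sum_i a i)%N.
  by rewrite muln_gt0 a0 andbT prodn_gt0 // => j; have [] := nP j.
rewrite expgnA -/u; exists (u ^+ (\sum_i a i), (\sum_i (v i : 'rV[int]_m) *+ a i)%R) => // l _.
(* If l is not in the support of a, then (u, v_i) is in H_l for all i in this
   support; otherwise l is not in the support of b, and b gives the same element. *)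
have [al|bl] := ab l; last rewrite sab vab.
  apply: (subgroup_combination (sH l)) => i ai; apply: (vP i).
  by apply: contraNneq ai => <-; rewrite al.
apply: (subgroup_combination (sH l)) => i bi; apply: (vP i).
by apply: contraNneq bi => <-; rewrite bl.
Qed.

Lemma top_configuration_not_realizable :
  ~ realizable G (top_configuration m.+2).
Proof.
move=> [H [sH HP]].
have fgI (J : {set 'I_m.+2}) (J0 : J != finset.set0) :
    J != [set: 'I_m.+2]%SET -> finitely_generated (\bigcap_(i in [set` J]) H i).
  move=> JT; have [+ _] := HP (exist (fun J : {set _} => is_true (J != finset.set0)) J J0).
  by apply; apply/negbTE.
have full0 : [set: 'I_m.+2]%SET != finset.set0.
  by apply/finset.set0Pn; exists ord0; rewrite finset.inE.
have [_ +] := HP (exist (fun J : {set _} => is_true (J != finset.set0)) _ full0).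
apply; first by rewrite /top_configuration /= eqxx.
have -> : \bigcap_(i in [set` [set: 'I_m.+2]%SET]) H i = \bigcap_i H i.
  by apply: eq_bigcapl; split=> i //= _; rewrite finset.inE.
have ord01 : ord0 != ord_max :> 'I_m.+2 by [].
apply: finitely_generated_helly => j.
  have -> : H j = \bigcap_(i in [set` [set j]%SET]) H i.
    have -> : [set` [set j]%SET] = [set j].
      by apply/seteqP; split=> i /=; rewrite finset.inE => /eqP.
    by rewrite bigcap_set1.
  apply: fgI; first by apply/finset.set0Pn; exists j; rewrite finset.inE.
  by rewrite -finset.properT finset.properEcard finset.subsetT finset.cards1 finset.cardsT card_ord.
have -> : [set i | i != j] = [set` [set~ j]%SET].
  by apply/seteqP; split=> i /=; rewrite !finset.inE.
apply: fgI.
  have [-> |j0] := eqVneq j ord0.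
    by apply/finset.set0Pn; exists ord_max; rewrite !finset.inE eq_sym.
  by apply/finset.set0Pn; exists ord0; rewrite !finset.inE eq_sym.
by apply/eqP => /finset.setP/(_ j); rewrite !finset.inE eqxx.
Qed.

End Helly.

(** * The realization *)

Section Realization.
Local Open Scope group_scope.
Local Open Scope classical_set_scope.
Import GRing.Theory Num.Theory.

(** The trivial colouring satisfies the criterion for the whole group. *)
Lemma finitely_generated_free_group (T : finType) :
  finitely_generated [set: free_group T].
Proof.
apply: generated_by_prefix_cosets; first by split.
exact: (@finitely_many_cosets_colour _ _ _ unit (fun=> tt)).
Qed.

Lemma top_configuration_realizable m :
  realizable (F2 * Zpow m)%type (top_configuration m.+1).
Proof.
pose G : groupType := (F2 * Zpow m)%type.
pose a : F2 := fg_gen (ord0 : 'I_2); pose b : F2 := fg_gen (ord_max : 'I_2).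
have [ht [htM hta htb]] : exists ht : F2 -> int,
    [/\ forall x y, ht (x * y) = (ht x + ht y)%R, ht a = 1%R & ht b = 0%R].
  have [ht [[htM htg] _]] := free_group_universal
    (fun i : 'I_2 => (if i == ord0 then 1 else 0)%R : Algebra.to_multiplicative int).
  by exists ht; split; [exact: htM|exact: htg|exact: htg].
have ht1 : ht 1 = 0%R by apply: (addrI (ht 1)); rewrite -htM mulg1 addr0.
have htV x : ht x^-1 = (- ht x)%R.
  by apply: (addrI (ht x)); rewrite -htM mulgV ht1 subrr.
have htX n : ht (a ^+ n) = n%:R%R.
  by elim: n => // n IH; rewrite expgS htM hta IH -natr1 addrC.
(* The last index stands for |w| - (v_1 + ... + v_m), so that the y_i sum to |w|. *)
pose y (i : 'I_m.+1) (x : G) : int :=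
  if unlift ord_max i is Some j then (x.2 : 'rV[int]_m) ord0 j
  else (ht x.1 - \sum_j (x.2 : 'rV[int]_m) ord0 j)%R.
have yM i x z : y i (x * z) = (y i x + y i z)%R.
  rewrite /y; case: unliftP => [j|] _ /=; first by rewrite mxE.
  rewrite htM; under eq_bigr do rewrite mxE.
  by rewrite big_split /= opprD addrACA.
have y1 i : y i 1 = 0%R by apply: (addrI (y i 1)); rewrite -yM mulg1 addr0.
have yV i x : y i x^-1 = (- y i x)%R.
  by apply: (addrI (y i x)); rewrite -yM mulgV y1 subrr.
pose H i : set G := [set x | y i x = 0%R].
have sH i : is_subgroup (H i).
  split=> [|x z Hx Hz|x Hx]; rewrite /H /= ?y1 ?yM ?yV //.
    by rewrite Hx Hz addr0.
  by rewrite Hx oppr0.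
exists H; split=> // -[J J0] /=; rewrite /top_configuration /=; split; last first.
  move/eqP=> {J0}->; set D := \bigcap_(i in _) H i => Dfg.
  have fstM : {morph (fst : G -> F2) : x z / x * z} by [].
  have memD w v : D (w, v) <-> v = 1 /\ ht w = 0%R.
    split=> [Dwv|[-> w0] i _]; last first.
      rewrite /H /= /y; case: unliftP => [j|] _ /=; first by rewrite mxE.
      by rewrite w0 big1 ?subr0 // => j _; rewrite mxE.
    have yD i : y i (w, v) = 0%R by apply: Dwv; rewrite /= finset.inE.
    have v0 : v = 1.
      by apply/rowP => j; have := yD (lift ord_max j); rewrite /y liftK mxE.
    split=> //; have := yD ord_max; rewrite /y unlift_none /= big1 ?subr0 // => j _.
    by rewrite v0 mxE.
  have [n n0] : exists2 n, 0 < n & (fst @` D) (a ^+ n).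
    apply: normalizer_torsion.
    - exact: (finitely_generated_image fstM Dfg).
    - by exists b => //; exists (b, 1) => //; apply/memD.
    - move=> _ [[w v] /memD[v1 w0] <-]; exists (a * w / a, 1) => //; apply/memD.
      by split=> //; rewrite !htM htV w0 addr0 subrr.
  move=> [[w v] /memD[_ w0] /= wE]; move: w0; rewrite wE htX => /eqP.
  by rewrite pnatr_eq0 -leqn0 leqNgt n0.
move/negbT; rewrite -finset.subTset => /subsetPn[j _ jJ].
apply: finitely_generated_fst; first by apply: subgroup_bigcap.
have -> : fst @` (\bigcap_(i in [set` J]) H i) = [set: F2].
  apply/seteqP; split=> // w _.
  suff [v yv] : exists v : Zpow m, forall i, i != j -> y i (w, v) = 0%R.
    by exists (w, v) => // i /= iJ; apply: yv; apply: contraNneq jJ => <-.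
  (* The vector v with y_j = |w| and all other y_i = 0. *)
  case: (unliftP ord_max j) => [l|] ->.
    exists (ht w *: delta_mx ord0 l)%R => i; rewrite /y; case: unliftP => [l'|] -> /=.
      rewrite (inj_eq lift_inj) !mxE eqxx /= => /negbTE->.
      by rewrite mulr0.
    move=> _; rewrite (bigD1 l) //= big1 => [|l' /negbTE ll']; rewrite !mxE eqxx ?ll' /=.
      by rewrite eqxx mulr1 addr0 subrr.
    by rewrite mulr0.
  exists 0%R => i; rewrite /y; case: unliftP => [l'|] -> /=; first by rewrite mxE.
  by rewrite eqxx.
exact: finitely_generated_free_group.
Qed.

End Realization.

Theorem proposition4p5 :
  (forall k : nat, 1 <= k ->
     realizable (F2 * Zpow (k - 1))%type (top_configuration k)) /\
  (forall k : nat, 2 <= k ->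
     ~ realizable (F2 * Zpow (k - 2))%type (top_configuration k)).
Proof.
split=> [[|m] // _|[|[|m]] // _].
- by rewrite subn1; apply: top_configuration_realizable.
- by rewrite subn2; apply: top_configuration_not_realizable.
Qed.
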